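(* Let $\mathbf X=(X,\mathbb X^{(2)})\in\mathscr C^p([0,T];\mathbb R^d)$, $p\in(2,3)$, be a rough path, let $\widehat X:=(\cdot,X,Q(X))$ be the path extended by time and the rough path bracket terms, with corresponding rough path $\widehat{\mathbf X}=(\widehat X,\widehat{\mathbb X}^{(2)})\in\mathscr C^p([0,T];\mathbb R^{\hat d})$, and let $\widehat{\mathbb X}$ be Lyons' extension of $\widehat{\mathbf X}$ to $T((\mathbb R^{\hat d}))$. Then for any two multi-indices $I,J$ with entries in $\{0,\dots,\hat d-1\}$, $$\langle e_I,\widehat{\mathbb X}_t\rangle\,\langle e_J,\widehat{\mathbb X}_t\rangle=\langle e_I\mathbin{\widetilde{\sqcup\!\sqcup}}e_J,\widehat{\mathbb X}_t\rangle,\qquad t\in[0,T],$$ where $\mathbin{\widetilde{\sqcup\!\sqcup}}$ is the quasi-shuffle product.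
   Context: Fix $T>0$, $d\in\mathbb N$; $\Delta_T=\{(s,t)\in[0,T]^2:s\le t\}$, $X_{s,t}:=X_t-X_s$. $T(\mathbb R^m)=\bigoplus_{n\ge0}(\mathbb R^m)^{\otimes n}$, $T((\mathbb R^m))=\prod_{n\ge0}(\mathbb R^m)^{\otimes n}$; for a multi-index $I=(i_1,\dots,i_n)$, $e_I=e_{i_1}\otimes\cdots\otimes e_{i_n}$, $e_\emptyset=1$, $I'=(i_1,\dots,i_{n-1})$, $|I|=n$; $\langle\ell,\mathbf a\rangle=\sum_I\ell_I\langle e_I,\mathbf a\rangle$ for $\ell=\sum_I\ell_Ie_I\in T(\mathbb R^m)$, $\mathbf a\in T((\mathbb R^m))$, with $\langle e_I,\mathbf a\rangle$ the $e_I$-coordinate. A rough path $\mathbf X=(X,\mathbb X^{(2)})\in\mathscr C^p([0,T];\mathbb R^m)$ consists of a continuous $X\colon[0,T]\to\mathbb R^m$ of finite $p$-variation and a continuous $\mathbb X^{(2)}\colon\Delta_T\to\mathbb R^{m\times m}$ of finite $p/2$-variation with $\mathbb X^{(2)}_{s,t}=\mathbb X^{(2)}_{s,u}+\mathbb X^{(2)}_{u,t}+X_{s,u}\otimes X_{u,t}$ for $s\le u\le t$. Its bracket is $[\mathbf X]_t=X_{0,t}\otimes X_{0,t}-(\mathbb X^{(2)}_{0,t}+(\mathbb X^{(2)}_{0,t})^\top)$. For $\mathbf X\in\mathscr C^p([0,T];\mathbb R^d)$: $Q(X)=([\mathbf X]^{ij})_{1\le i\le j\le d}$, $\hat d=1+d+\frac{d(d+1)}2$,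 $\widehat X_t=(t,X_t,Q(X)_t)$. The canonical basis of $\mathbb R^{\hat d}$ is $(e_0,e_1,\dots,e_d,\epsilon_{11},\dots,\epsilon_{1d},\epsilon_{22},\dots,\epsilon_{2d},\dots,\epsilon_{dd})=(e_0,\dots,e_{\hat d-1})$: $e_0$ for time, $e_1,\dots,e_d$ for $X$, $\epsilon_{ij}$ ($i\le j$) for $[\mathbf X]^{ij}$; set $\epsilon_{ji}:=\epsilon_{ij}$ for $i,j\in\{1,\dots,d\}$, and $\epsilon_{ij}:=0$ if $i,j\in\{0,\dots,\hat d-1\}$ are not both in $\{1,\dots,d\}$. The lift is $(\widehat{\mathbb X}^{(2)})^{ij}=(\mathbb X^{(2)})^{ij}$ for $i,j\in\{1,\dots,d\}$ and the Young integral $(\widehat{\mathbb X}^{(2)}_{s,t})^{ij}=\int_s^t\widehat X^i_{s,r}\mathrm d\widehat X^j_r$ otherwise. Lyons' extension of $(X,\mathbb X^{(2)})\in\mathscr C^p([0,T];\mathbb R^m)$ is the unique continuous $\mathbb X=(1,X_{s,t},\mathbb X^{(2)}_{s,t},\mathbb X^{(3)}_{s,t},\dots)\colon\Delta_T\to T((\mathbb R^m))$ with $\mathbb X_{s,u}\otimes\mathbb X_{u,t}=\mathbb X_{s,t}$ and with $\mathbb X^{(n)}$ of finite $p/n$-variation for every $n$; $\mathbb X_t:=\mathbb X_{0,t}$. Quasi-shuffle product: for multi-indices $I,J$ with entries in $\{0,\dots,\hat d-1\}$, recursively $e_I\mathbin{\widetilde{\sqcup\!\sqcup}}e_\emptyset=e_\emptyset\mathbin{\widetilde{\sqcup\!\sqcup}}e_I=e_I$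 and, for $I,J\neq\emptyset$, $$e_I\mathbin{\widetilde{\sqcup\!\sqcup}}e_J=(e_{I'}\mathbin{\widetilde{\sqcup\!\sqcup}}e_J)\otimes e_{i_{|I|}}+(e_I\mathbin{\widetilde{\sqcup\!\sqcup}}e_{J'})\otimes e_{j_{|J|}}+(e_{I'}\mathbin{\widetilde{\sqcup\!\sqcup}}e_{J'})\otimes\epsilon_{i_{|I|}j_{|J|}}.$$ *)

(* Defs.v *)
From HB Require Import structures.
From mathcomp Require Import all_boot all_order all_algebra.
From mathcomp Require Import finmap.
From mathcomp Require Import all_classical all_reals all_analysis.
(* The notations of monalg clash with those of mathcomp-analysis; [malg K R]
   is {malg R[K]} and [fmonom I] is {fmonom I}, the free monoid on I. *)
From mathcomp Require Import -(notations) monalg.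

Set Implicit Arguments.
Unset Strict Implicit.
Unset Printing Implicit Defensive.

Import Order.TTheory GRing.Theory Num.Theory.
Import numFieldNormedType.Exports.

Local Open Scope classical_set_scope.
Local Open Scope ring_scope.

Section Tensors.
Variables (R : realType) (m : nat).

(* T(R^m), the monoid algebra of words: its ring product is the tensor
   product. *)
Definition tensor_algebra := malg (fmonom 'I_m) R.

Definition basis_tensor (I : seq 'I_m) : tensor_algebra := mkmalgU (FMonom I) 1.

(* T((R^m)); [a I] is the e_I-coordinate of [a]. *)
Definition tensor_series := seq 'I_m -> R.

Definition pairing (l : tensor_algebra) (a : tensor_series) : R :=
  \sum_(w <- msupp l) mcoeff w l * a w.

Definition tensor_series_mul (a b : tensor_series) : tensor_series :=
  fun w => \sum_(k < (size w).+1) a (take k w) * b (drop k w).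

(* The max norm of the component in (R^m)^{\otimes n}. *)
Definition level_norm (n : nat) (a : tensor_series) : R :=
  \big[Num.max/0]_(w : n.-tuple 'I_m) `|a w|.

Definition vec_tensor (u v : 'rV[R]_m) : 'M[R]_m := u^T *m v.

End Tensors.

Section RoughPaths.
Variable R : realType.
Implicit Types (T p q : R).

Definition simplex T : set (R * R) :=
  [set st | [/\ 0 <= st.1, st.1 <= st.2 & st.2 <= T]].

(* [N s t] is the norm of the two-parameter object at (s, t). *)
Definition q_variation (a b q : R) (N : R -> R -> R) (s : seq R) : R :=
  let t := nth b (a :: s) in \sum_(0 <= k < size s) N (t k) (t k.+1) `^ q.

Definition finite_variation T q (N : R -> R -> R) : Prop :=
  has_ubound [set q_variation 0 T q N s | s in itv_partition 0 T].

Record rough_path (T p : R) (m : nat) := RoughPath {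
  rp_path : R -> 'rV[R]_m;
  rp_second : R -> R -> 'M[R]_m;
  rp_path_continuous : {within `[0, T], continuous rp_path};
  rp_path_variation :
    finite_variation T p (fun s t => `|rp_path t - rp_path s|);
  rp_second_continuous :
    {within simplex T, continuous (fun st => rp_second st.1 st.2)};
  rp_second_variation :
    finite_variation T (p / 2) (fun s t => `|rp_second s t|);
  rp_chen : forall s u t, 0 <= s -> s <= u -> u <= t -> t <= T ->
    rp_second s t = rp_second s u + rp_second u t
      + vec_tensor (rp_path u - rp_path s) (rp_path t - rp_path u)
}.

Definition bracket T p m (X : rough_path T p m) (t : R) : 'M[R]_m :=
  vec_tensor (rp_path X t - rp_path X 0) (rp_path X t - rp_path X 0)
  - (rp_second X 0 t + (rp_second X 0 t)^T).

(* T((R^m)) carries the product topology, hence the coordinatewise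
   continuity; [S] is constrained on the simplex only. *)
Record lyons_extension T p m (X : rough_path T p m)
    (S : R -> R -> tensor_series R m) : Prop := LyonsExtension {
  lyons_level0 : forall s t, simplex T (s, t) -> S s t [::] = 1;
  lyons_level1 : forall s t, simplex T (s, t) -> forall i,
    S s t [:: i] = (rp_path X t - rp_path X s) 0 i;
  lyons_level2 : forall s t, simplex T (s, t) -> forall i j,
    S s t [:: i; j] = rp_second X s t i j;
  lyons_continuous : forall w,
    {within simplex T, continuous (fun st => S st.1 st.2 w)};
  lyons_chen : forall s u t, 0 <= s -> s <= u -> u <= t -> t <= T ->
    tensor_series_mul (S s u) (S u t) = S s t;
  lyons_variation : forall n, (0 < n)%N ->
    finite_variation T (p / n%:R) (fun s t => level_norm n (S s t))
}.

Definition riemann_sum (f g : R -> R) (a b : R) (s : seq R) : R :=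
  let t := nth b (a :: s) in
  \sum_(0 <= k < size s) f (t k) * (g (t k.+1) - g (t k)).

Definition mesh_lt (a b delta : R) (s : seq R) : Prop :=
  let t := nth b (a :: s) in
  forall k, (k < size s)%N -> t k.+1 - t k < delta.

(* The Young integral of f against g over [a, b] exists and equals v. *)
Definition is_young_integral (f g : R -> R) (a b v : R) : Prop :=
  forall e, 0 < e -> exists2 delta, 0 < delta &
    forall s, itv_partition a b s -> mesh_lt a b delta s ->
      `|riemann_sum f g a b s - v| < e.

End RoughPaths.

Section ExtendedAlphabet.
Variable d : nat.

Definition ordered_pair := {ij : 'I_d * 'I_d | (ij.1 <= ij.2)%N}.

Lemma card_ordered_pair : #|{: ordered_pair}| = (d * d.+1)./2.
Proof.
rewrite card_sig -sum1_card.
transitivity (\sum_(i < d) \sum_(j < d | (i <= j)%N) 1)%N.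
  by rewrite pair_big_dep.
rewrite (exchange_big_dep xpredT) //=.
rewrite (eq_bigr (fun j : 'I_d => j.+1)) => [|j _]; last first.
  rewrite -(big_ord_widen d (fun=> 1%N) (ltn_ord j)).
  by rewrite sum1_card card_ord.
rewrite -(big_mkord xpredT succn) -(big_add1 _ _ 0 d.+1 xpredT id).
rewrite mulnC -(bin2 d.+1) -bin2_sum.
by rewrite [RHS]big_nat_recl // add0n big_add1.
Qed.

(* The enumeration is lexicographic: 11, ..., 1d, 22, ..., 2d, ..., dd. *)
Lemma val_enum_ordered_pair : map val (enum {: ordered_pair}) =
  [seq ij : 'I_d * 'I_d <- [seq (i, j) | i <- enum 'I_d, j <- enum 'I_d]
        | (ij.1 <= ij.2)%N].
Proof.
rewrite enumT unlock /= pmap_filter; last exact: insubK.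
rewrite [in LHS]unlock /= /prod_enum.
by apply: eq_filter => x; apply: isSome_insub.
Qed.

Definition hdim := (1 + d + (d * d.+1)./2)%N.

Definition time_index : 'I_hdim := lshift _ (lshift d ord0).

Definition space_index (i : 'I_d) : 'I_hdim := lshift _ (rshift 1 i).

Definition sort_pair_val (i j : 'I_d) : 'I_d * 'I_d :=
  if (i <= j)%N then (i, j) else (j, i).

Lemma sort_pairP i j : ((sort_pair_val i j).1 <= (sort_pair_val i j).2)%N.
Proof. by rewrite /sort_pair_val; case: (leqP i j) => [|/ltnW]. Qed.

Definition sort_pair (i j : 'I_d) : ordered_pair :=
  exist _ (sort_pair_val i j) (sort_pairP i j).

(* The index of \epsilon_{ij} = \epsilon_{ji}. *)
Definition bracket_index (i j : 'I_d) : 'I_hdim :=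
  rshift (1 + d) (cast_ord card_ordered_pair (enum_rank (sort_pair i j))).

Definition bracket_pair (k : 'I_((d * d.+1)./2)) : 'I_d * 'I_d :=
  val (enum_val (cast_ord (esym card_ordered_pair) k)).

(* [Some i] if k is the index of the i-th component of X, [None] for the time
   and bracket indices. *)
Definition space_of (k : 'I_hdim) : option 'I_d :=
  match fintype.split k with
  | inl k' => match fintype.split k' with inl _ => None | inr i => Some i end
  | inr _ => None
  end.

End ExtendedAlphabet.

Section HatPath.
Variables (R : realType) (T p : R) (d : nat).

Definition hat_path (X : rough_path T p d) (t : R) : 'rV[R]_(hdim d) :=
  row_mx (row_mx (const_mx t) (rp_path X t))
    (\row_k bracket X t (bracket_pair k).1 (bracket_pair k).2).

Lemma hat_path_time (X : rough_path T p d) t :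
  hat_path X t 0 (time_index d) = t.
Proof. by rewrite !row_mxEl mxE. Qed.

Lemma hat_path_space (X : rough_path T p d) t i :
  hat_path X t 0 (space_index i) = rp_path X t 0 i.
Proof. by rewrite row_mxEl row_mxEr. Qed.

Lemma hat_path_bracket (X : rough_path T p d) t i j :
  hat_path X t 0 (bracket_index i j) = bracket X t i j.
Proof.
have bracket_sym k l : bracket X t k l = bracket X t l k.
  by rewrite !mxE !big_ord1 !mxE mulrC [_ + rp_second _ _ _ _ _]addrC.
rewrite row_mxEr mxE /bracket_pair cast_ordK enum_rankK /= /sort_pair_val.
by case: leqP.
Qed.

(* The level-2 components other than those of X itself are Young integrals. *)
Record extended_rough_path (X : rough_path T p d)
    (hX : rough_path T p (hdim d)) : Prop := ExtendedRoughPath {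
  extended_path : forall t, 0 <= t <= T -> rp_path hX t = hat_path X t;
  extended_second : forall s t, simplex T (s, t) -> forall k l,
    match space_of k, space_of l with
    | Some i, Some j => rp_second hX s t k l = rp_second X s t i j
    | _, _ =>
        is_young_integral (fun r => rp_path hX r 0 k - rp_path hX s 0 k)
          (fun r => rp_path hX r 0 l) s t (rp_second hX s t k l)
    end
}.

End HatPath.

Section QuasiShuffle.
Variables (R : realType) (d : nat).

Local Notation e_ := (@basis_tensor R (hdim d)).

Definition epsilon (k l : 'I_(hdim d)) : tensor_algebra R (hdim d) :=
  match space_of k, space_of l with
  | Some i, Some j => e_ [:: bracket_index i j]
  | _, _ => 0
  end.

(* The recursion is on the last letters, hence on the reversed words. *)
Fixpoint quasi_shuffle_rev (I J : seq 'I_(hdim d)) {struct I} :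
    tensor_algebra R (hdim d) :=
  let fix inner J :=
    match I, J with
    | [::], _ => e_ (rev J)
    | _, [::] => e_ (rev I)
    | i :: I', j :: J' =>
        quasi_shuffle_rev I' J * e_ [:: i] + inner J' * e_ [:: j]
        + quasi_shuffle_rev I' J' * epsilon i j
    end
  in inner J.

Definition quasi_shuffle (I J : seq 'I_(hdim d)) :=
  quasi_shuffle_rev (rev I) (rev J).

Lemma quasi_shuffle0l J : quasi_shuffle [::] J = e_ J.
Proof. by rewrite -[in RHS](revK J) /quasi_shuffle; case: (rev J). Qed.

Lemma quasi_shuffle0r I : quasi_shuffle I [::] = e_ I.
Proof. by rewrite -[in RHS](revK I) /quasi_shuffle; case: (rev I). Qed.

Lemma quasi_shuffle_rcons I J i j :
  quasi_shuffle (rcons I i) (rcons J j) =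
    quasi_shuffle I (rcons J j) * e_ [:: i]
    + quasi_shuffle (rcons I i) J * e_ [:: j]
    + quasi_shuffle I J * epsilon i j.
Proof. by rewrite /quasi_shuffle !rev_rcons. Qed.

End QuasiShuffle.

(* Main.v *)
Require Import Defs.
From mathcomp Require Import all_boot all_order all_algebra.
From mathcomp Require Import all_classical all_reals all_analysis.
From mathcomp Require Import -(notations) monalg.
From mathcomp Require Import zify ring lra.

(* Deconcatenation is a morphism for the quasi-shuffle product.  Hence, by
   induction on |I| + |J|, Chen's relation makes the defect
     D_{s,t}(I, J) = <e_I, S_{s,t}> <e_J, S_{s,t}> - <e_I * e_J, S_{s,t}>
   additive in (s, t), so D = 0 once the sums of D over uniform partitions of
   [0, t] tend to 0.  Level n >= 3 of S, and products of total level >= 3, have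
   finite q-variation with q < 1 and are small near the diagonal, so their sums
   tend to 0.  The remaining terms of level 2 contain a time or bracket letter,
   so they are Young integrals; by Chen's relation their sum over a partition is
   the integral minus its Riemann sum.  For |I| = |J| = 1 with two space letters
   the identity is the definition of the bracket. *)

Set Implicit Arguments.
Unset Strict Implicit.
Unset Printing Implicit Defensive.

Import Order.TTheory GRing.Theory Num.Theory.
Import numFieldNormedType.Exports.

Local Open Scope classical_set_scope.
Local Open Scope ring_scope.

(** * Words *)

Section Pairing.
Variables (R : realType) (m : nat).
Implicit Types (a b : tensor_series R m) (x y : tensor_algebra R m).

Lemma pairingE x a :
  pairing x a = mmap idfun (fun w : fmonom 'I_m => a w) x.
Proof. by []. Qed.

Lemma pairingD x y a : pairing (x + y) a = pairing x a + pairing y a.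
Proof. by rewrite !pairingE raddfD. Qed.

Lemma pairing0 a : pairing 0 a = 0.
Proof. by rewrite pairingE raddf0. Qed.

Lemma pairing_basis (I : seq 'I_m) a : pairing (basis_tensor R I) a = a I.
Proof. by rewrite pairingE mmapU /= mul1r. Qed.

(** Tensoring on the right by a letter appends it to every word of [x], which the series can absorb
    instead. *)
Lemma pairing_mul_letter x a k :
  pairing (x * basis_tensor R [:: k]) a = pairing x (a \o rcons^~ k).
Proof.
rewrite malgM_def fgmulgU pairingE raddf_sum /=; apply: eq_bigr => w _.
rewrite mmapU mulr1 /=; congr (_ * _).
rewrite -cats1.
exact: (congr1 (fun u : fmonom 'I_m => a u) (fmmulE w (FMonom [:: k]))).
Qed.

Lemma tensor_series_mul_cons a b i w :
  tensor_series_mul a b (i :: w) =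
  a [::] * b (i :: w) + tensor_series_mul (a \o cons i) b w.
Proof. by rewrite /tensor_series_mul /= big_ord_recl. Qed.

(** Reversal exchanges prefixes and suffixes, so the two factors swap; this carries Chen's relation
    over to words written backwards. *)
Lemma tensor_series_mul_rev a b w :
  tensor_series_mul a b (rev w) = tensor_series_mul (b \o rev) (a \o rev) w.
Proof.
rewrite /tensor_series_mul size_rev (reindex_inj rev_ord_inj) /=.
apply: eq_bigr => k _; rewrite mulrC subSS.
by rewrite take_rev drop_rev subKn // -ltnS.
Qed.

End Pairing.

(** * Quasi-shuffles as lists of words, and deconcatenation *)

Section QuasiShuffleWords.
Variables (m : nat) (eps : 'I_m -> 'I_m -> option 'I_m).
Implicit Types I J : seq 'I_m.

(* The terms of the quasi-shuffle product of the words [rev I] and [rev J],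
   with multiplicity; all words are written backwards. *)
Fixpoint qsh (I J : seq 'I_m) {struct I} : seq (seq 'I_m) :=
  let fix inner J :=
    match I, J with
    | [::], _ => [:: J]
    | _, [::] => [:: I]
    | i :: I', j :: J' =>
        map (cons i) (qsh I' J) ++ map (cons j) (inner J')
        ++ (if eps i j is Some k then map (cons k) (qsh I' J') else [::])
    end
  in inner J.

Lemma qsh_nil_l J : qsh [::] J = [:: J].
Proof. by case: J. Qed.

Lemma qsh_nil_r I : qsh I [::] = [:: I].
Proof. by case: I. Qed.

Lemma qsh_cons i I j J :
  qsh (i :: I) (j :: J) =
    map (cons i) (qsh I (j :: J)) ++ map (cons j) (qsh (i :: I) J)
    ++ (if eps i j is Some k then map (cons k) (qsh I J) else [::]).
Proof. by []. Qed.

(** Every step of the recursion keeps a letter or merges two letters into one at least as heavy. *)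
Lemma qsh_weight (wt : 'I_m -> nat) :
  (forall i j k, eps i j = Some k -> (wt i + wt j <= wt k)%N) ->
  forall I J w, w \in qsh I J ->
  (\sum_(i <- I) wt i + \sum_(j <- J) wt j <= \sum_(k <- w) wt k)%N.
Proof.
move=> wt_eps; elim=> [|i I IHI] J.
  by move=> w; rewrite qsh_nil_l inE => /eqP ->; rewrite big_nil.
elim: J => [|j J IHJ] w.
  by rewrite qsh_nil_r inE => /eqP ->; rewrite big_nil addn0.
rewrite qsh_cons !mem_cat => /or3P[] .
- move=> /mapP[v /IHI lev ->]; move: lev; rewrite !big_cons; lia.
- move=> /mapP[v /IHJ lev ->]; move: lev; rewrite !big_cons; lia.
- case eps_ij: (eps i j) => [k|//] /mapP[v /IHI lev ->].
  move: lev (wt_eps _ _ _ eps_ij); rewrite !big_cons; lia.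
Qed.

Variable R : realType.
Implicit Types (a b : tensor_series R m).

Definition qsum a I J := \sum_(w <- qsh I J) a w.

Lemma qsum_nil_l a J : qsum a [::] J = a J.
Proof. by rewrite /qsum qsh_nil_l big_seq1. Qed.

Lemma qsum_nil_r a I : qsum a I [::] = a I.
Proof. by rewrite /qsum qsh_nil_r big_seq1. Qed.

Definition qsum_eps a i j I J :=
  if eps i j is Some k then qsum (a \o cons k) I J else 0.

Lemma qsum_cons a i I j J :
  qsum a (i :: I) (j :: J) =
    qsum (a \o cons i) I (j :: J) + qsum (a \o cons j) (i :: I) J
    + qsum_eps a i j I J.
Proof.
rewrite /qsum qsh_cons !big_cat /= !big_map addrA /qsum_eps.
by case: (eps i j) => [k|]; rewrite ?big_map ?big_nil.
Qed.

(** Linearity, in the shape produced by [tensor_series_mul_cons]. *)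
Lemma qsumMDl a b c (x : R) I J :
  (forall w, c w = x * a w + b w) ->
  qsum c I J = x * qsum a I J + qsum b I J.
Proof.
move=> cE; rewrite /qsum mulr_sumr -big_split /=.
by apply: eq_bigr => w _; rewrite cE.
Qed.

(* Deconcatenation is a morphism for the quasi-shuffle product. *)
Lemma qsum_tensor_series_mul a b I J :
  qsum (tensor_series_mul a b) I J =
  \sum_(k < (size I).+1) \sum_(l < (size J).+1)
     qsum a (take k I) (take l J) * qsum b (drop k I) (drop l J).
Proof.
elim: I J a b => [|i I IHI] J a b.
  rewrite big_ord1 qsum_nil_l /tensor_series_mul.
  by apply: eq_bigr => l _; rewrite !qsum_nil_l.
elim: J a b => [|j J IHJ] a b.
  rewrite qsum_nil_r /tensor_series_mul.
  by apply: eq_bigr => k _; rewrite big_ord1 !qsum_nil_r.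
rewrite qsum_cons.
have tmul_cons k w : (tensor_series_mul a b \o cons k) w =
    a [::] * (b \o cons k) w + tensor_series_mul (a \o cons k) b w.
  exact: tensor_series_mul_cons.
rewrite !(qsumMDl _ _ (tmul_cons _)) IHI IHJ.
have -> : qsum_eps (tensor_series_mul a b) i j I J =
    a [::] * qsum_eps b i j I J +
    \sum_(k < (size I).+1) \sum_(l < (size J).+1)
       qsum_eps a i j (take k I) (take l J) * qsum b (drop k I) (drop l J).
  rewrite /qsum_eps; case: (eps i j) => [e|].
    by rewrite (qsumMDl _ _ (tmul_cons _)) IHI.
  rewrite mulr0 add0r big1 // => k _; rewrite big1 // => l _.
  by rewrite mul0r.
(* [A], [B] and [C] are the three terms that [qsum_cons] gives for a pair of nonempty prefixes. The
   splittings below isolate the boundary terms, in which a prefix is empty. *)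
set A := fun (k l : nat) =>
  qsum (a \o cons i) (take k I) (j :: take l J) * qsum b (drop k I) (drop l J).
set B := fun (k l : nat) =>
  qsum (a \o cons j) (i :: take k I) (take l J) * qsum b (drop k I) (drop l J).
set C := fun (k l : nat) =>
  qsum_eps a i j (take k I) (take l J) * qsum b (drop k I) (drop l J).
have split_l : \sum_(k < (size I).+1) \sum_(l < (size (j :: J)).+1)
    qsum (a \o cons i) (take k I) (take l (j :: J))
      * qsum b (drop k I) (drop l (j :: J)) =
    \sum_(k < (size I).+1) a (i :: take k I) * qsum b (drop k I) (j :: J)
    + \sum_(k < (size I).+1) \sum_(l < (size J).+1) A k l.
  rewrite -big_split; apply: eq_bigr => k _ /=.
  by rewrite big_ord_recl /= qsum_nil_r.
have split_k : \sum_(k < (size (i :: I)).+1) \sum_(l < (size J).+1)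
    qsum (a \o cons j) (take k (i :: I)) (take l J)
      * qsum b (drop k (i :: I)) (drop l J) =
    \sum_(l < (size J).+1) a (j :: take l J) * qsum b (i :: I) (drop l J)
    + \sum_(k < (size I).+1) \sum_(l < (size J).+1) B k l.
  rewrite big_ord_recl /=; congr (_ + _).
  by apply: eq_bigr => l _; rewrite qsum_nil_l.
have split_kl : \sum_(k < (size (i :: I)).+1) \sum_(l < (size (j :: J)).+1)
    qsum a (take k (i :: I)) (take l (j :: J))
      * qsum b (drop k (i :: I)) (drop l (j :: J)) =
    a [::] * qsum b (i :: I) (j :: J)
    + \sum_(l < (size J).+1) a (j :: take l J) * qsum b (i :: I) (drop l J)
    + (\sum_(k < (size I).+1) a (i :: take k I) * qsum b (drop k I) (j :: J)
       + \sum_(k < (size I).+1) \sum_(l < (size J).+1) (A k l + B k l + C k l)).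
  rewrite big_ord_recl big_ord_recl /= qsum_nil_l; congr (_ + _ + _).
    by apply: eq_bigr => l _; rewrite qsum_nil_l.
  rewrite -big_split; apply: eq_bigr => k _ /=.
  rewrite big_ord_recl /= qsum_nil_r; congr (_ + _); apply: eq_bigr => l _.
  by rewrite qsum_cons 2!mulrDl.
rewrite split_l split_k split_kl qsum_cons.
under [X in _ = _ + (_ + X)]eq_bigr do rewrite 2!big_split.
rewrite 2!big_split /=; ring.
Qed.

End QuasiShuffleWords.

(** [epsilon] as a partial operation on letters; [None] stands for the value 0. *)
Definition letter_bracket d (i j : 'I_(hdim d)) : option 'I_(hdim d) :=
  if space_of i is Some a then
    if space_of j is Some b then Some (bracket_index a b) else None
  else None.

(** Both sides obey the same recursion on last letters, which are the heads of the reversed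
    words. *)
Lemma pairing_quasi_shuffle (R : realType) d (I J : seq 'I_(hdim d))
    (a : tensor_series R (hdim d)) :
  pairing (quasi_shuffle R I J) a =
  qsum (@letter_bracket d) (a \o rev) (rev I) (rev J).
Proof.
rewrite /quasi_shuffle; move: (rev I) (rev J) => {I J}.
move=> I J; elim: I J a => [|i I IHI] J a.
  by case: J => [|j J]; rewrite qsum_nil_l [quasi_shuffle_rev _ _ _]/=
    pairing_basis.
elim: J a => [|j J IHJ] a.
  by rewrite qsum_nil_r [quasi_shuffle_rev _ _ _]/= pairing_basis.
have -> : quasi_shuffle_rev R (i :: I) (j :: J) =
   quasi_shuffle_rev R I (j :: J) * basis_tensor R [:: i]
   + quasi_shuffle_rev R (i :: I) J * basis_tensor R [:: j]
   + quasi_shuffle_rev R I J * epsilon R i j by [].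
rewrite (pairingD (_ + _)) (pairingD (_ * _)) qsum_cons.
have rev_cons_comp k : (a \o rev) \o cons k = (a \o rcons^~ k) \o rev.
  by apply/funext => w /=; rewrite rev_cons.
congr (_ + _ + _).
- by rewrite (pairing_mul_letter (quasi_shuffle_rev R I (j :: J))) IHI
    rev_cons_comp.
- by rewrite (pairing_mul_letter (quasi_shuffle_rev R (i :: I) J)) IHJ
    rev_cons_comp.
- rewrite /epsilon /qsum_eps /letter_bracket.
  case: (space_of i) => [u|]; last by rewrite mulr0 pairing0.
  case: (space_of j) => [v|]; last by rewrite mulr0 pairing0.
  by rewrite (pairing_mul_letter (quasi_shuffle_rev R I J)) IHI rev_cons_comp.
Qed.

(** * Sums over uniform partitions *)

Section UniformPartition.
Variable R : realType.
Implicit Types (t : R) (F G : R -> R -> R).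

(** Dividing by [n.+1] makes every [n] admissible; the grid has [n.+1] intervals. *)
Definition grid t n k : R := t * k%:R / n.+1%:R.

Lemma grid0 t n : grid t n 0 = 0.
Proof. by rewrite /grid mulr0 mul0r. Qed.

Lemma grid_last t n : grid t n n.+1 = t.
Proof. by rewrite /grid mulfK. Qed.

Lemma gridB t n k : grid t n k.+1 - grid t n k = t / n.+1%:R.
Proof. by rewrite /grid -mulrBl -mulrBr -natrB // subSnn mulr1. Qed.

Lemma grid_le t n j k : 0 <= t -> (j <= k)%N -> grid t n j <= grid t n k.
Proof. by move=> t0 jk; rewrite ler_wpM2r // ler_wpM2l // ler_nat. Qed.

Lemma grid_lt t n j k : 0 < t -> (j < k)%N -> grid t n j < grid t n k.
Proof. by move=> t0 jk; rewrite ltr_pM2r // ltr_pM2l // ltr_nat. Qed.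

Lemma grid_ge0 t n k : 0 <= t -> 0 <= grid t n k.
Proof. by move=> t0; rewrite -(grid0 t n) grid_le. Qed.

Lemma grid_le_last t n k : 0 <= t -> (k <= n.+1)%N -> grid t n k <= t.
Proof. by move=> t0 kn; rewrite -[leRHS](grid_last t n) grid_le. Qed.

Lemma grid_simplex (T : R) t n k : 0 <= t <= T -> (k < n.+1)%N ->
  simplex T (grid t n k, grid t n k.+1).
Proof.
move=> /andP[t0 tT] kn; split => /=; first exact: grid_ge0.
  exact: grid_le.
by rewrite (le_trans _ tT) // grid_le_last.
Qed.

Lemma grid_mesh t (delta : R) : 0 < delta ->
  \forall n \near \oo, forall k, grid t n k.+1 - grid t n k < delta.
Proof.
move=> delta0; have : (fun n => t * n.+1%:R^-1) @ \oo --> (t * 0 : R).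
  by apply: cvgMr; exact: cvg_harmonic.
rewrite mulr0 => /cvgr0_norm_lt /(_ _ delta0); apply: filterS => n ltn k.
by rewrite gridB (le_lt_trans (ler_norm _)).
Qed.

(** The index starts at 1 because [itv_partition] leaves out the left endpoint. *)
Definition grid_seq t n := [seq grid t n k | k <- iota 1 n.+1].

Lemma size_grid_seq t n : size (grid_seq t n) = n.+1.
Proof. by rewrite size_map size_iota. Qed.

Lemma nth_grid_seq x t n k : (k <= n.+1)%N ->
  nth x (0 :: grid_seq t n) k = grid t n k.
Proof.
move=> kn.
have -> : 0 :: grid_seq t n = [seq grid t n j | j <- iota 0 n.+2].
  by rewrite /= grid0.
by rewrite (nth_map 0) ?size_iota // nth_iota.
Qed.

Lemma itv_partition_grid t n : 0 < t -> itv_partition 0 t (grid_seq t n).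
Proof.
move=> t0; split.
  apply/(pathP 0) => k; rewrite size_grid_seq => kn.
  rewrite (nth_grid_seq _ _ (ltnW kn)).
  have -> : nth 0 (grid_seq t n) k = nth 0 (0 :: grid_seq t n) k.+1 by [].
  by rewrite nth_grid_seq // grid_lt.
by rewrite (last_nth 0) size_grid_seq nth_grid_seq // grid_last.
Qed.

Definition grid_sum F t n :=
  \sum_(0 <= k < n.+1) F (grid t n k) (grid t n k.+1).

(** A grid of [0, t] extends to a partition of [0, T], and the extra term of the variation is
    nonnegative; hence one bound serves all [t] and [n]. *)
Lemma finite_variation_grid (T q : R) N : finite_variation T q N ->
  exists2 C, 0 <= C & forall t n, 0 < t <= T ->
    grid_sum (fun r s => N r s `^ q) t n <= C.
Proof.
move=> [C ubC]; exists (Num.max 0 C); first by rewrite le_max lexx.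
move=> t n /andP[t0 tT].
(* Partitions are strictly increasing, so [T] is appended only when it differs from [t]. *)
pose s := grid_seq t n ++ (if t < T then [:: T] else [::]).
have sP : itv_partition 0 T s.
  apply: (itv_partition_cat (itv_partition_grid n t0)).
  case: ltrP => [|Tt]; first exact: itv_partition1.
  by split=> //=; rewrite eq_le Tt tT.
have /le_trans -> // : grid_sum (fun r s => N r s `^ q) t n
    <= q_variation 0 T q N s; last first.
  by rewrite le_max; apply/orP; right; apply: ubC; exists s.
rewrite /q_variation size_cat size_grid_seq.
rewrite (big_cat_nat (n := n.+1)) //= ?leq_addr //.
rewrite -[leLHS]addr0 lerD //; last first.
  by apply: sumr_ge0 => k _; exact: powR_ge0.
rewrite le_eqVlt; apply/orP; left; apply/eqP.
apply: eq_big_nat => k /andP[_ kn].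
have nth_s j : (j <= n.+1)%N -> nth T (0 :: s) j = grid t n j.
  move=> jn; rewrite -cat_cons nth_cat.
  rewrite -[size _]/(size (grid_seq t n)).+1 size_grid_seq ltnS jn.
  exact: nth_grid_seq.
by rewrite -[nth T s k]/(nth T (0 :: s) k.+1) !nth_s // ltnW.
Qed.

End UniformPartition.

(* With M the maximum of the right-hand terms, x <= M^(a/p) and y <= M^(b/p). *)
Lemma powRM_le_add (R : realType) (x y p : R) (a b : nat) :
  0 <= x -> 0 <= y -> 0 < p -> (0 < a)%N -> (0 < b)%N ->
  (x * y) `^ (p / (a + b)%:R) <= x `^ (p / a%:R) + y `^ (p / b%:R).
Proof.
move=> x0 y0 p0 a0 b0.
have nneg (z c : R) : 0 <= z `^ c by exact: powR_ge0.
set u := x `^ _; set v := y `^ _.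
pose M := Num.max u v.
have M0 : 0 <= M by rewrite le_max nneg.
have root_le z c : 0 <= z -> (0 < c)%N -> z `^ (p / c%:R) <= M ->
    z <= M `^ (c%:R / p).
  move=> z0 c0 zM; have -> : z = (z `^ (p / c%:R)) `^ (c%:R / p).
    rewrite -powRrM mulrA divfK ?pnatr_eq0 -?lt0n //.
    by rewrite divff ?powRr1 // gt_eqF.
  by apply: ge0_ler_powR; rewrite ?nnegrE ?divr_ge0 ?(ltW p0).
have xyM : x * y <= M `^ ((a + b)%:R / p).
  (* [M] may be 0; the side condition of [powRD] holds because the total exponent is positive. *)
  rewrite natrD mulrDl powRD; last first.
    apply/implyP => /eqP; have : 0 < a%:R / p + b%:R / p.
      by rewrite addr_gt0 // divr_gt0 // ltr0n.
    by move=> + h; rewrite h ltxx.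
  apply: ler_pM => //; apply: root_le => //; first by rewrite le_max lexx.
  by rewrite le_max lexx orbT.
have ab0 : (0 < a + b)%N by rewrite addn_gt0 a0.
apply: (@le_trans _ _ M); last by rewrite ge_max lerDl lerDr !nneg.
apply: (@le_trans _ _ ((M `^ ((a + b)%:R / p)) `^ (p / (a + b)%:R))).
  by apply: ge0_ler_powR; rewrite ?nnegrE ?mulr_ge0 ?invr_ge0 ?(ltW p0).
rewrite -powRrM mulrA divfK ?gt_eqF // divff ?powRr1 //.
by rewrite gt_eqF // ltr0n.
Qed.

(** * Two-parameter functions whose grid sums tend to 0 *)

Section VanishingSums.
Variables (R : realType) (T : R).
Implicit Types (F G : R -> R -> R) (p q : R).

Definition vanishing F :=
  forall t, 0 < t <= T -> grid_sum F t @ \oo --> (0 : R).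

Lemma vanishing_ext F G :
  (forall s t : R, simplex T (s, t) -> F s t = G s t) ->
  vanishing F -> vanishing G.
Proof.
move=> FG F0 t tT.
have -> : grid_sum G t = grid_sum F t; last exact: F0.
apply/funext => n; apply: eq_big_nat => k /andP[_ kn].
rewrite FG //; apply: grid_simplex => //.
by case/andP: tT => /ltW -> ->.
Qed.

Lemma vanishing0 : vanishing (fun _ _ => 0).
Proof.
move=> t _; rewrite (_ : grid_sum _ t = cst 0); first exact: cvg_cst.
by apply/funext => n; rewrite /grid_sum big1.
Qed.

Lemma vanishingD F G : vanishing F -> vanishing G ->
  vanishing (fun s t => F s t + G s t).
Proof.
move=> F0 G0 t tT.
rewrite (_ : grid_sum _ t = grid_sum F t \+ grid_sum G t).
  by rewrite -(addr0 (0 : R)); apply: cvgD; [exact: F0|exact: G0].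
by apply/funext => n; rewrite /grid_sum big_split.
Qed.

Lemma vanishingN F : vanishing F -> vanishing (fun s t => - F s t).
Proof.
move=> F0 t tT; rewrite (_ : grid_sum _ t = - grid_sum F t).
  by rewrite -(oppr0 R); apply: cvgN; exact: F0.
by apply/funext => n; rewrite /grid_sum sumrN.
Qed.

Lemma vanishing_sum (I : eqType) (r : seq I) (F : I -> R -> R -> R) :
  (forall i, i \in r -> vanishing (F i)) ->
  vanishing (fun s t => \sum_(i <- r) F i s t).
Proof.
elim: r => [_|i r IHr Fr].
  by apply: vanishing_ext vanishing0 => s t _; rewrite big_nil.
apply: (@vanishing_ext (fun s t => F i s t + \sum_(j <- r) F j s t)).
  by move=> s t _; rewrite big_cons.
apply: vanishingD; first by apply: Fr; rewrite inE eqxx.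
by apply: IHr => j jr; apply: Fr; rewrite inE jr orbT.
Qed.

(** The grid sums of an additive [F] telescope to the constant [F 0 t], which is therefore 0; then
    additivity on 0, [s], [t] gives the claim. *)
Lemma additive_vanishing_eq0 F :
  (forall s u t : R, 0 <= s -> s <= u -> u <= t -> t <= T ->
     F s t = F s u + F u t) ->
  vanishing F -> forall s t : R, simplex T (s, t) -> F s t = 0.
Proof.
move=> Fadd F0.
have F_start (t : R) : 0 <= t -> t <= T -> F 0 t = 0.
  rewrite le_eqVlt => /predU1P[<- T0|t0 tT].
    by have := Fadd 0 0 0 (lexx _) (lexx _) (lexx _) T0; lra.
  have gridF n k : (k <= n.+1)%N ->
      \sum_(0 <= j < k) F (grid t n j) (grid t n j.+1) = F 0 (grid t n k).
    elim: k => [_|k IHk kn].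
      rewrite big_nil grid0.
      have T0 : 0 <= T by rewrite ltW // (lt_le_trans t0).
      by have := Fadd 0 0 0 (lexx _) (lexx _) (lexx _) T0; lra.
    have tT' : 0 <= t <= T by rewrite ltW.
    have [/= g0 gk gT] := grid_simplex tT' kn.
    by rewrite big_nat_recr //= IHk ?(ltnW kn) // -Fadd.
  have : 0 < t <= T by rewrite t0.
  move=> /F0; rewrite (_ : grid_sum F t = cst (F 0 t)).
    by move=> /(cvg_lim (@Rhausdorff R)); rewrite lim_cst.
  by apply/funext => n; rewrite /grid_sum gridF // grid_last.
move=> s t [/= s0 st tT]; have := Fadd 0 s t (lexx _) s0 st tT.
by rewrite !F_start ?(le_trans st) ?(le_trans s0) // add0r.
Qed.

Definition small_near_diagonal F :=
  forall e, 0 < e -> exists2 delta, 0 < delta &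
  forall s t : R, simplex T (s, t) -> t - s < delta -> `|F s t| < e.

(** Write |F| = |F|^(1-q) |F|^q: on a fine grid the first factor is uniformly small, and the second
    has bounded sums. *)
Lemma vanishing_variation F q : 0 < q < 1 -> small_near_diagonal F ->
  finite_variation T q (fun s t => `|F s t|) -> vanishing F.
Proof.
move=> /andP[q0 q1] Fsmall /finite_variation_grid[C C0 leC] t tT.
apply/cvgr0Pnorm_le => e e0.
have q10 : 1 - q != 0 by rewrite subr_eq0 gt_eqF.
(* Chosen so that h^(1-q) C = e C / (C + 1) <= e; the added 1 covers C = 0. *)
pose h := (e / (C + 1)) `^ (1 - q)^-1.
have hE : h `^ (1 - q) = e / (C + 1).
  by rewrite -powRrM mulVf // powRr1 // divr_ge0 ?ltW // ltr_wpDl.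
have h0 : 0 < h by rewrite powR_gt0 // divr_gt0 // ltr_wpDl.
have [delta delta0 Fdelta] := Fsmall h h0.
apply: filterS (grid_mesh t delta0) => n mesh_n.
have tT' : 0 <= t <= T by case/andP: tT => /ltW -> ->.
have : grid_sum (fun r s => `|F r s|) t n <= e / (C + 1) * C.
  apply: le_trans
    (_ : _ <= e / (C + 1) * grid_sum (fun r s => `|F r s| `^ q) t n) _.
    rewrite /grid_sum mulr_sumr; apply: ler_sum_nat => k /andP[_ kn].
    have F_lt := Fdelta _ _ (grid_simplex tT' kn) (mesh_n k).
    set x := `|F _ _| in F_lt *.
    have [->|x0] := eqVneq x 0.
      by rewrite mulr_ge0 ?powR_ge0 // divr_ge0 ?ltW // ltr_wpDl.
    rewrite -[leLHS]powRr1 ?normr_ge0 // -[1 in leLHS](subrK q) powRD;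
      last exact/implyP.
    rewrite ler_wpM2r ?powR_ge0 // -hE ge0_ler_powR ?nnegrE ?subr_ge0 ?ltW //.
    by rewrite lt_neqAle eq_sym x0 normr_ge0.
  by rewrite ler_wpM2l ?leC // divr_ge0 ?ltW // ltr_wpDl.
move=> /(le_trans (ler_norm_sum _ _ _)) /le_trans; apply.
rewrite mulrAC ler_pdivrMr ?ltr_wpDl // ler_pM2l //; lra.
Qed.

(** The number [a] acts as a degree: level [a] of a Lyons extension is the model, and degrees add
    under products. *)
Definition regular p a F := small_near_diagonal F /\
  finite_variation T (p / a%:R) (fun s t => `|F s t|).

Lemma regularM p a b F G : 0 < p -> (0 < a)%N -> (0 < b)%N ->
  regular p a F -> regular p b G ->
  regular p (a + b) (fun s t => F s t * G s t).
Proof.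
move=> p0 a0 b0 [Fsmall [C FC]] [Gsmall [D GD]]; split.
  move=> e e0; have [d1 d10 Fd] := Fsmall e e0.
  have [d2 d20 Gd] := Gsmall 1 ltr01.
  exists (Num.min d1 d2); first by rewrite lt_min d10.
  move=> s t st; rewrite lt_min => /andP[/(Fd _ _ st) Fe /(Gd _ _ st) G1].
  rewrite normrM -[e]mulr1 ltr_pM //.
exists (C + D) => _ [s sP <-].
apply: le_trans (lerD (FC _ _) (GD _ _)); last 2 first.
- by exists s.
- by exists s.
rewrite /q_variation -big_split /=; apply: ler_sum => k _.
by rewrite normrM powRM_le_add.
Qed.

(** Here p < 3 <= a makes the variation exponent p/a smaller than 1. *)
Lemma regular_vanishing p a F : 0 < p < 3 -> (3 <= a)%N -> regular p a F ->
  vanishing F.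
Proof.
move=> /andP[p0 p3] a3 [Fsmall Fvar]; apply: vanishing_variation Fsmall Fvar.
have a0 : (0 : R) < a%:R by rewrite ltr0n (leq_trans _ a3).
rewrite divr_gt0 //= ltr_pdivrMr // mul1r (lt_le_trans p3) //.
by rewrite ler_nat.
Qed.

(** Continuity at each diagonal point gives a local bound; compactness of [0, T] makes it
    uniform. *)
Lemma small_near_diagonal_continuous F :
  {within simplex T, continuous (fun st => F st.1 st.2)} ->
  (forall t : R, 0 <= t <= T -> F t t = 0) -> small_near_diagonal F.
Proof.
move=> Fc F0 e e0.
have /compact_near_coveringP cover := @segment_compact R 0 T.
(* The free centre [x] makes the property local, as near-covering compactness requires; in the end
   [x] is [s]. *)
pose P (delta x : R) := forall s t, simplex T (s, t) ->
  `|x - s| < delta -> `|x - t| < delta -> `|F s t| < e.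
have [delta delta0 Pdelta] : exists2 delta, 0 < delta & `[0, T] `<=` P delta.
  have : \forall delta \near 0^'+, `[0, T] `<=` P delta.
    apply: cover => x; rewrite /= in_itv /= => xT.
    have sxx : simplex T (x, x) by case/andP: xT.
    have /= := (subspace_continuousP _ _).1 Fc (x, x) sxx.
    move=> /cvgrPdist_lt /(_ _ e0); rewrite near_withinE.
    move=> /nbhs_ballP[/= eta eta0 ball_eta].
    have eta20 : 0 < eta / 2 by rewrite divr_gt0.
    (* One half of [eta] is for the distance from [x] to [x'], the other for that from [x'] to [s]
       or [t]. *)
    exists (ball x (eta / 2), [set delta | delta < eta / 2]) => /=.
      split; first exact: nbhsx_ballx.
      exact: nbhs_right_lt.
    move=> [x' delta] /= [xx' delta_lt].
    have dist_x r : `|x' - r| < delta -> `|x - r| < eta.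
      move=> xr; rewrite -(subrKA x') (le_lt_trans (ler_normD _ _)) //.
      by rewrite (splitr eta) ltrD // (lt_trans xr).
    move=> s t st /dist_x xs /dist_x xt.
    have := ball_eta (s, t) (conj xs xt) st.
    by rewrite /from_subspace /= F0 // sub0r normrN.
  move=> near_P; have [delta [delta0 Pdelta]] := @filter_ex _ 0^'+ _ _
    (filterI (nbhs_right_gt (0 : R)) near_P).
  by exists delta.
exists delta => // s t st ts; have [/= s0 le_st tT] := st.
apply: (Pdelta s) => //; rewrite ?subrr ?normr0 //.
  by rewrite /= in_itv /= s0 (le_trans le_st).
by rewrite distrC ger0_norm ?subr_ge0.
Qed.

Lemma small_mul_time_vanishing F : small_near_diagonal F ->
  vanishing (fun s t => F s t * (t - s)).
Proof.
move=> Fsmall t tT; apply/cvgr0Pnorm_le => e e0.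
have /andP[t0 tT1] := tT.
(* The time increments of the grid add up to [t], whence the bound e / t. *)
have [delta delta0 Fdelta] := Fsmall (e / t) (divr_gt0 e0 t0).
apply: filterS (grid_mesh t delta0) => n mesh_n.
have tT' : 0 <= t <= T by rewrite ltW.
apply: le_trans (ler_norm_sum _ _ _) _.
apply: le_trans (_ : \sum_(0 <= k < n.+1) e / t * (t / n.+1%:R) <= _).
  apply: ler_sum_nat => k /andP[_ kn]; rewrite normrM gridB.
  rewrite [X in _ * X <= _]ger0_norm ?divr_ge0 ?(ltW t0) // ler_wpM2r //.
    by rewrite divr_ge0 ?(ltW t0).
  exact/ltW/(Fdelta _ _ (grid_simplex tT' kn))/mesh_n.
by rewrite sumr_const_nat subn0 -[leLHS]mulr_natr -mulrA !divfK ?gt_eqF.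
Qed.

(* Summing Chen's relation over a partition expresses the Riemann sum through
   the increments of [v]. *)
Lemma young_vanishing (f g : R -> R) (v : R -> R -> R) :
  (forall s u t : R, 0 <= s -> s <= u -> u <= t -> t <= T ->
     v s t = v s u + v u t + (f u - f s) * (g t - g u)) ->
  (forall t : R, 0 <= t <= T ->
     is_young_integral (fun r => f r - f 0) g 0 t (v 0 t)) ->
  vanishing v.
Proof.
move=> chen young t tT; have /andP[t0 tT1] := tT.
have T0 : 0 <= T by rewrite ltW // (lt_le_trans t0).
have tT' : 0 <= t <= T by rewrite ltW.
have v00 : v 0 0 = 0.
  by have := chen 0 0 0 (lexx _) (lexx _) (lexx _) T0; rewrite subrr mul0r; lra.
(* Induction on [k], with Chen's relation at 0 and two consecutive grid points. *)
have sum_v n k : (k <= n.+1)%N ->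
    \sum_(0 <= j < k) v (grid t n j) (grid t n j.+1) = v 0 (grid t n k)
    - \sum_(0 <= j < k) (f (grid t n j) - f 0) *
        (g (grid t n j.+1) - g (grid t n j)).
  elim: k => [_|k IHk kn]; first by rewrite !big_nil grid0 v00 subr0.
  rewrite !big_nat_recr //= IHk ?(ltnW kn) //.
  have [/= g0 gk gT] := grid_simplex tT' kn.
  by rewrite (chen 0 (grid t n k) (grid t n k.+1)) //; ring.
apply/cvgr0Pnorm_lt => e e0; have [delta delta0 rs] := young t tT' e e0.
apply: filterS (grid_mesh t delta0) => n mesh_n.
have -> : grid_sum v t n =
    v 0 t - riemann_sum (fun r => f r - f 0) g 0 t (grid_seq t n).
  rewrite /grid_sum sum_v // grid_last /riemann_sum size_grid_seq.
  congr (_ - _); apply: eq_big_nat => k /andP[_ kn].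
  by rewrite !nth_grid_seq // ltnW.
rewrite distrC; apply: rs => [|x k]; first exact: itv_partition_grid.
rewrite size_grid_seq /x => kn.
by rewrite !nth_grid_seq // ltnW.
Qed.

End VanishingSums.

(** * The quasi-shuffle identity *)

Section Defect.
Variables (R : realType) (m : nat) (eps : 'I_m -> 'I_m -> option 'I_m).
Implicit Types (a b : tensor_series R m) (I J : seq 'I_m).

Definition defect a I J := a I * a J - qsum eps a I J.

Lemma defect_nil_l a J : a [::] = 1 -> defect a [::] J = 0.
Proof. by move=> a1; rewrite /defect qsum_nil_l a1 mul1r subrr. Qed.

Lemma defect_nil_r a I : a [::] = 1 -> defect a I [::] = 0.
Proof. by move=> a1; rewrite /defect qsum_nil_r a1 mulr1 subrr. Qed.

(** After deconcatenation of both sides, a splitting with shorter prefixes and shorter suffixes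
    contributes nothing, since both factors have zero defect there. Only the two extreme splittings
    remain. *)
Lemma defect_tensor_series_mul a b I J :
  a [::] = 1 -> b [::] = 1 -> (0 < size I + size J)%N ->
  (forall I' J', (size I' + size J' < size I + size J)%N ->
     defect a I' J' = 0) ->
  (forall I' J', (size I' + size J' < size I + size J)%N ->
     defect b I' J' = 0) ->
  defect (tensor_series_mul a b) I J = defect a I J + defect b I J.
Proof.
move=> a1 b1 IJ0 a0 b0; rewrite [LHS]/defect qsum_tensor_series_mul.
rewrite {1 2}/tensor_series_mul big_distrlr /= -sumrB.
under eq_bigr do rewrite -sumrB.
rewrite pair_bigA /= (bigD1 (ord0, ord0)) //=.
(* The splitting (0, 0) yields the defect of [b], this one that of [a]; they differ as [I] and [J]
   are not both empty. *)
rewrite (bigD1 (ord_max, ord_max)) /=; last first.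
  by rewrite xpair_eqE -!val_eqE /=; lia.
rewrite !take0 !drop0 !take_size !drop_size !qsum_nil_l a1 b1.
rewrite big1 ?addr0 => [|[k l] /andP[kl0 klm]] /=.
  by rewrite /defect; ring.
have qa : qsum eps a (take k I) (take l J) = a (take k I) * a (take l J).
  apply/esym/eqP; rewrite -subr_eq0; apply/eqP/a0.
  move: klm; rewrite xpair_eqE -!val_eqE /= !size_take_min.
  by have := ltn_ord k; have := ltn_ord l; lia.
have qb : qsum eps b (drop k I) (drop l J) = b (drop k I) * b (drop l J).
  apply/esym/eqP; rewrite -subr_eq0; apply/eqP/b0.
  move: kl0; rewrite xpair_eqE -!val_eqE /= !size_drop.
  by have := ltn_ord k; have := ltn_ord l; lia.
by rewrite qa qb; ring.
Qed.

End Defect.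

(** * Regularity of the coordinates of a Lyons extension *)

Section LyonsExtension.
Variables (R : realType) (T p : R) (m : nat) (X : rough_path T p m).
Variable S : R -> R -> tensor_series R m.
Hypotheses (p0 : 0 < p) (SX : lyons_extension X S).

(** In Chen's relation at (t, t, t) the proper splittings vanish by induction on the length, and the
    two trivial ones leave 2 x = x. *)
Lemma lyons_extension_diagonal (t : R) w : 0 <= t <= T -> (0 < size w)%N ->
  S t t w = 0.
Proof.
move=> /andP[t0 tT]; have [n] := ubnP (size w); elim: n w => // n IHn w wn w0.
have St1 : S t t [::] = 1 by apply: (lyons_level0 SX); split.
have := congr1 (fun a => a w) (lyons_chen SX t0 (lexx t) (lexx t) tT).
rewrite /tensor_series_mul big_ord_recr /= take_size drop_size St1 mulr1.
case: w => // i w in wn w0 *; rewrite big_ord_recl /= St1 mul1r big1.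
  by lra.
move=> k _; rewrite IHn ?mul0r //= size_take_min.
by have kw : (k < size w)%N := ltn_ord k; move: wn => /=; lia.
Qed.

Lemma lyons_extension_regular w : (0 < size w)%N ->
  regular T p (size w) (fun s t => S s t w).
Proof.
move=> w0; split.
  apply: small_near_diagonal_continuous; first exact: (lyons_continuous SX).
  by move=> t tT; exact: lyons_extension_diagonal.
have [C ubC] := lyons_variation SX w0.
exists C => _ [s sP <-]; apply: le_trans (ubC _ _); last by exists s.
apply: ler_sum => k _; set u := nth T _ k; set v := nth T _ k.+1.
have Sle : `|S u v w| <= level_norm (size w) (S u v).
  exact: (le_bigmax 0 (fun z : (size w).-tuple 'I_m => `|S u v z|)
    (in_tuple w)).
apply: ge0_ler_powR => //; rewrite ?nnegrE //.
  by rewrite divr_ge0 ?(ltW p0).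
exact: le_trans Sle.
Qed.

End LyonsExtension.

(** * Time, space and bracket letters *)

Section Letters.
Variable d : nat.

Lemma space_of_rshift (k : 'I_(d * d.+1)./2) :
  space_of (rshift (1 + d) k : 'I_(hdim d)) = None.
Proof. by rewrite /space_of (unsplitK (inr _ k)). Qed.

Lemma space_of_space_index (i : 'I_d) : space_of (space_index i) = Some i.
Proof.
by rewrite /space_of /space_index (unsplitK (inl _ (rshift 1 i)))
  (unsplitK (inr _ i)).
Qed.

Lemma space_of_inj a (i : 'I_d) : space_of a = Some i -> a = space_index i.
Proof.
rewrite /space_of; case: (split_ordP a) => // b ->.
by case: (split_ordP b) => // j -> [->].
Qed.

Variant letter_spec : 'I_(hdim d) -> Prop :=
| LetterTime : letter_spec (time_index d)
| LetterSpace i : letter_spec (space_index i)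
| LetterBracket (k : 'I_(d * d.+1)./2) : letter_spec (rshift (1 + d) k).

Lemma letterP a : letter_spec a.
Proof.
case: (split_ordP a) => [b ->|k ->]; last exact: LetterBracket.
case: (split_ordP b) => [c ->|i ->]; last exact: LetterSpace.
by rewrite (ord1 c); exact: LetterTime.
Qed.

(* A bracket letter replaces two letters, hence the weight 2; this rules out
   terms of level 2 without time or bracket letter when |I| + |J| > 2. *)
Definition letter_weight (a : 'I_(hdim d)) :=
  if space_of a is Some _ then 1%N else 2%N.

Lemma letter_weight_bracket (a b c : 'I_(hdim d)) :
  letter_bracket a b = Some c ->
  (letter_weight a + letter_weight b <= letter_weight c)%N.
Proof.
rewrite /letter_bracket /letter_weight.
case: (space_of a) => // i; case: (space_of b) => // j [<-].
by rewrite space_of_rshift.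
Qed.

End Letters.

(** * Vanishing of the defect for the extended rough path *)

Section Extended.
Variables (R : realType) (T p : R) (d : nat) (X : rough_path T p d).
Variables (hX : rough_path T p (hdim d)).
Variables (S : R -> R -> tensor_series R (hdim d)).
Hypotheses (p23 : 2 < p < 3) (XhX : extended_rough_path X hX).
Hypothesis ShX : lyons_extension hX S.

Let p0 : 0 < p. Proof. by case/andP: p23; lra. Qed.

Let p03 : 0 < p < 3. Proof. by rewrite p0; case/andP: p23. Qed.

Let regularS w : (0 < size w)%N -> regular T p (size w) (fun s t => S s t w).
Proof. exact: lyons_extension_regular p0 ShX _. Qed.

Lemma level1E (s t : R) k : simplex T (s, t) ->
  S s t [:: k] = hat_path X t 0 k - hat_path X s 0 k.
Proof.
move=> st; have [/= s0 le_st tT] := st; rewrite (lyons_level1 ShX st).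
have -> : rp_path hX t = hat_path X t.
  by rewrite (extended_path XhX) // (le_trans s0).
have -> : rp_path hX s = hat_path X s.
  by rewrite (extended_path XhX) // s0 (le_trans le_st).
by rewrite [LHS]mxE [X in _ + X = _]mxE.
Qed.

Lemma level1_time (s t : R) : simplex T (s, t) ->
  S s t [:: time_index d] = t - s.
Proof. by move=> st; rewrite level1E // !hat_path_time. Qed.

Lemma level1_space (s t : R) i : simplex T (s, t) ->
  S s t [:: space_index i] = rp_path X t 0 i - rp_path X s 0 i.
Proof. by move=> st; rewrite level1E // !hat_path_space. Qed.

Lemma level2_space (s t : R) i j : simplex T (s, t) ->
  S s t [:: space_index i; space_index j] = rp_second X s t i j.
Proof.
move=> st; rewrite (lyons_level2 ShX st).
have := extended_second XhX st (space_index i) (space_index j).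
by rewrite !space_of_space_index.
Qed.

(** Chen's relation on 0, [s], [t] cancels everything that precedes [s]. The increment thus becomes
    an expression of degree 2 in the extension over [s, t]. *)
Lemma bracketB (s t : R) i j : simplex T (s, t) ->
  bracket X t i j - bracket X s i j =
  S s t [:: space_index i] * S s t [:: space_index j]
  - S s t [:: space_index i; space_index j]
  - S s t [:: space_index j; space_index i].
Proof.
move=> st; have [/= s0 le_st tT] := st.
rewrite !level1_space // !level2_space // /bracket /vec_tensor.
rewrite (rp_chen X (lexx 0) s0 le_st tT) /vec_tensor !mxE !big_ord1 !mxE.
by ring.
Qed.

Lemma level1_rshift (s t : R) (k : 'I_(d * d.+1)./2) : simplex T (s, t) ->
  S s t [:: rshift (1 + d) k] =
  bracket X t (bracket_pair k).1 (bracket_pair k).2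
  - bracket X s (bracket_pair k).1 (bracket_pair k).2.
Proof. by move=> st; rewrite level1E // !row_mxEr !mxE. Qed.

Lemma level1_bracket_index (s t : R) i j : simplex T (s, t) ->
  S s t [:: bracket_index i j] = bracket X t i j - bracket X s i j.
Proof. by move=> st; rewrite level1E // !hat_path_bracket. Qed.

Lemma level2_young_vanishing a b : ~~ (space_of a && space_of b) ->
  vanishing T (fun s t => S s t [:: a; b]).
Proof.
move=> ab; apply: (@vanishing_ext _ _ (fun s t => rp_second hX s t a b)).
  by move=> s t st; rewrite (lyons_level2 ShX st).
apply: (@young_vanishing _ _ (fun t => rp_path hX t 0 a)
  (fun t => rp_path hX t 0 b)).
  move=> s u t s0 su ut tT; rewrite (rp_chen hX s0 su ut tT).
  by rewrite /vec_tensor !mxE big_ord1 !mxE.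
move=> t /andP[t0 tT].
have /(_ (And3 (lexx 0) t0 tT)) := @extended_second _ _ _ _ _ _ XhX 0 t.
move=> /(_ a b); move: ab.
by case: (space_of a) => [i|] //; case: (space_of b).
Qed.

(** A time increment is summable against a small factor; a bracket increment has degree 2 by
    [bracketB], so the product has degree 3. *)
Lemma level1_mul_vanishing a b : ~~ space_of a ->
  vanishing T (fun s t => S s t [:: a] * S s t [:: b]).
Proof.
case: (letterP a) => [_|i|k _]; last 2 first.
- by rewrite space_of_space_index.
- case bk: (bracket_pair k) => [i j].
  set x := space_index i; set y := space_index j.
  apply: (@vanishing_ext _ _ (fun s t =>
      S s t [:: x] * S s t [:: y] * S s t [:: b]
      + - (S s t [:: x; y] * S s t [:: b])
      + - (S s t [:: y; x] * S s t [:: b]))).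
    move=> s t st; rewrite level1_rshift // bk bracketB // -/x -/y.
    by ring.
  apply: vanishingD; first apply: vanishingD.
  + apply: (@regular_vanishing _ _ p (1 + 1 + 1)) => //.
    apply: regularM => //; first apply: regularM => //.
    * exact: (regularS (w := [:: x])).
    * exact: (regularS (w := [:: y])).
    * exact: (regularS (w := [:: b])).
  + apply/vanishingN/(@regular_vanishing _ _ p (2 + 1)) => //.
    by apply: regularM => //; [exact: (regularS (w := [:: x; y]))|];
      exact: (regularS (w := [:: b])).
  + apply/vanishingN/(@regular_vanishing _ _ p (2 + 1)) => //.
    by apply: regularM => //; [exact: (regularS (w := [:: y; x]))|];
      exact: (regularS (w := [:: b])).
apply: (@vanishing_ext _ _ (fun s t => S s t [:: b] * (t - s))).
  by move=> s t st; rewrite level1_time // mulrC.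
by apply: small_mul_time_vanishing; case: (regularS (w := [:: b])).
Qed.

(** Words are read backwards to match [qsh]. *)
Let Srev s t : tensor_series R (hdim d) := S s t \o rev.

Let defectS s t I J := defect (@letter_bracket d) (Srev s t) I J.

Lemma defect_letters_vanishing a b :
  vanishing T (fun s t => defectS s t [:: a] [:: b]).
Proof.
have defectE s t : defectS s t [:: a] [:: b] = S s t [:: a] * S s t [:: b]
    - (S s t [:: b; a] + S s t [:: a; b]
       + if letter_bracket a b is Some c then S s t [:: c] else 0).
  rewrite /defectS /defect qsum_cons qsum_nil_l qsum_nil_r /qsum_eps.
  by case: (letter_bracket a b) => [c|]; rewrite ?qsum_nil_l.
(* For two space letters the defect is exactly 0 by [bracketB]; otherwise there is no bracket letter
   and each term vanishes separately. *)
have [/andP[]|ab] := boolP (space_of a && space_of b).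
  case space_a: (space_of a) => [i|//].
  case space_b: (space_of b) => [j|//] _ _.
  have := defectE; rewrite /letter_bracket space_a space_b.
  rewrite (space_of_inj space_a) (space_of_inj space_b) => {}defectE.
  apply: vanishing_ext (vanishing0 (T := T)) => s t st; rewrite defectE.
  by rewrite level1_bracket_index // bracketB //; ring.
have bracket0 : letter_bracket a b = None.
  rewrite /letter_bracket; move: ab.
  by case: (space_of a) => // i; case: (space_of b).
apply: (@vanishing_ext _ _ (fun s t => S s t [:: a] * S s t [:: b]
    + - (S s t [:: b; a] + S s t [:: a; b]))).
  by move=> s t _; rewrite defectE bracket0 addr0.
apply: vanishingD; last first.
  apply/vanishingN/vanishingD; apply: level2_young_vanishing => //.
  by rewrite andbC.
move: ab; rewrite negb_and => /orP[|] ab; first exact: level1_mul_vanishing.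
apply: vanishing_ext (level1_mul_vanishing a ab) => s t _.
exact: mulrC.
Qed.

(** One letter is too light. Two letters of weight above 2 include a time or bracket letter, so
    Young integration applies; longer words have degree at least 3. *)
Lemma word_vanishing w : (2 < \sum_(k <- w) letter_weight k)%N ->
  vanishing T (fun s t => S s t w).
Proof.
have weight_le2 a : (letter_weight a <= 2)%N.
  by rewrite /letter_weight; case: (space_of a).
case: w => [|a [|b [|c w]]].
- by rewrite big_nil.
- by rewrite big_seq1 ltnNge weight_le2.
- rewrite !big_cons big_nil addn0 => weight_ab; apply: level2_young_vanishing.
  by move: weight_ab; rewrite /letter_weight; do 2 case: (space_of _).
- by move=> _; apply: (@regular_vanishing _ _ p _ _ p03 _ (regularS _)).
Qed.

(** The product of coordinates has degree at least 3, and by [qsh_weight] each word of the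
    quasi-shuffle weighs at least 3. *)
Lemma defect_vanishing I J : (0 < size I)%N -> (0 < size J)%N ->
  (2 < size I + size J)%N -> vanishing T (fun s t => defectS s t I J).
Proof.
move=> I0 J0 IJ2.
apply: (@vanishing_ext _ _ (fun s t => S s t (rev I) * S s t (rev J)
    + - \sum_(w <- qsh (@letter_bracket d) I J) S s t (rev w))) => //.
apply: vanishingD; last apply/vanishingN/vanishing_sum => w wIJ.
  apply: (@regular_vanishing _ _ p (size (rev I) + size (rev J))) => //.
    by rewrite !size_rev.
  by apply: regularM; rewrite ?size_rev //; rewrite -size_rev; apply: regularS;
    rewrite size_rev.
apply: word_vanishing; rewrite (perm_big w) ?perm_rev //=.
apply: leq_trans (qsh_weight (@letter_weight_bracket d) wIJ).
have size_weight (K : seq 'I_(hdim d)) :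
    (size K <= \sum_(k <- K) letter_weight k)%N.
  rewrite -sum1_size; apply: leq_sum => k _.
  by rewrite /letter_weight; case: (space_of k).
by rewrite (leq_trans IJ2) // leq_add.
Qed.

Lemma defect_eq0 I J (s t : R) : simplex T (s, t) -> defectS s t I J = 0.
Proof.
have [n] := ubnP (size I + size J)%N.
elim: n I J s t => // n IHn I J s t IJn st.
have S1 u v : simplex T (u, v) -> Srev u v [::] = 1.
  exact: (lyons_level0 ShX).
case: I J IJn => [|a I] [|b J] IJn; rewrite /defectS ?defect_nil_l ?defect_nil_r
  ?S1 //.
rewrite -/(defectS s t _ _).
apply: (@additive_vanishing_eq0 _ T
  (fun s t => defectS s t (a :: I) (b :: J))) st; last first.
  have [IJ2|IJ2] := leqP (size (a :: I) + size (b :: J)) 2; last first.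
    exact: defect_vanishing.
  have -> : I = [::] by apply: size0nil; move: IJ2 => /=; lia.
  have -> : J = [::] by apply: size0nil; move: IJ2 => /=; lia.
  exact: defect_letters_vanishing.
move=> r u v r0 ru uv vT.
have rv : simplex T (r, u) by split => //=; exact: le_trans vT.
have suv : simplex T (u, v) by split => //=; exact: le_trans ru.
(* The later interval comes first because reversing words swaps the factors. *)
have -> : defectS r v (a :: I) (b :: J) = defect (@letter_bracket d)
    (tensor_series_mul (Srev u v) (Srev r u)) (a :: I) (b :: J).
  rewrite /defectS; congr (defect _ _ _ _); apply/funext => w.
  by rewrite /Srev /= -(lyons_chen ShX r0 ru uv vT) tensor_series_mul_rev.
rewrite defect_tensor_series_mul ?S1 //; first by rewrite addrC.
- by move=> I' J' lt_IJ; apply: IHn => //; exact: leq_trans lt_IJ _.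
- by move=> I' J' lt_IJ; apply: IHn => //; exact: leq_trans lt_IJ _.
Qed.

End Extended.

Theorem proposition2p6 (R : realType) (T p : R) (d : nat)
  (X : rough_path T p d) (hX : rough_path T p (hdim d))
  (S : R -> R -> tensor_series R (hdim d)) :
  0 < T -> 2 < p < 3 ->
  extended_rough_path X hX ->
  lyons_extension hX S ->
  forall (I J : seq 'I_(hdim d)) (t : R), 0 <= t <= T ->
    pairing (basis_tensor R I) (S 0 t) * pairing (basis_tensor R J) (S 0 t) =
    pairing (quasi_shuffle R I J) (S 0 t).
Proof.
move=> _ p23 XhX ShX I J t /andP[t0 tT].
have st : simplex T (0, t) by split.
rewrite !pairing_basis pairing_quasi_shuffle; apply/eqP; rewrite -subr_eq0.
apply/eqP; have := defect_eq0 p23 XhX ShX (rev I) (rev J) st.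
by rewrite /defect /= !revK.
Qed.
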